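(* Let $M$ be an ${\bf R}^n$-aspherical manifold and let $g$ be an element of $N(\pi_1(M))$. Then there exist an element $\hat f$ of $Aff({\bf R}^n)$ and an element $\gamma$ of $\pi_1(M)$ such that $g=\gamma\circ\hat f$.
   Context: A group $G$ of homeomorphisms of ${\bf R}^n$ acts freely and properly discontinuously if (i) for all $x\in{\bf R}^n$ and $\gamma\in G$, $\gamma(x)=x$ implies $\gamma=Id_{{\bf R}^n}$; and (ii) every $x\in{\bf R}^n$ has an open neighbourhood $U$ such that for $\gamma\in G$, $\gamma(U)\cap U\neq\emptyset$ implies $\gamma=Id_{{\bf R}^n}$. An ${\bf R}^n$-aspherical manifold is a topological manifold $M$ given as the quotient of ${\bf R}^n$ by a group $G$ acting continuously, freely and properly discontinuously on ${\bf R}^n$; $G$ is identified with $\pi_1(M)$ (a group of homeomorphisms of ${\bf R}^n$), and $p_M:{\bf R}^n\to M$ is the quotient (covering) map. A homeomorphism $\hat f$ of ${\bf R}^n$ is a lift of a homeomorphism $f$ of $M$ if $p_M\circ\hat f=f\circ p_M$. $Aff({\bf R}^n)$ is the group of affine transformations of ${\bf R}^n$. $Aff(M)$ is the group of homeomorphisms of $M$ having at least one lift in $Aff({\bf R}^n)$. $N(\pi_1(M))$ is the group of all homeomorphisms of ${\bf R}^n$ that are lifts of elements of $Aff(M)$. *)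

(* Defs.v *)
From HB Require Import structures.
From mathcomp Require Import all_boot all_order all_algebra.
From mathcomp Require Import all_classical all_reals all_analysis.

Set Implicit Arguments.
Unset Strict Implicit.
Unset Printing Implicit Defensive.

Import Order.TTheory GRing.Theory Num.Theory.
Import numFieldNormedType.Exports.
Local Open Scope classical_set_scope.
Local Open Scope ring_scope.
Local Open Scope quotient_scope.

Definition homeomorphism (S T : topologicalType) (f : S -> T) : Prop :=
  continuous f /\
  exists g : T -> S, [/\ continuous g, cancel f g & cancel g f].

(* A chart around x is an open U containing x together with mutually inverse
   homeomorphisms phi, psi between U and the open set phi @` U; the values of
   phi and psi outside these sets are irrelevant. *)
Definition locally_euclidean (R : realType) (n : nat) (T : topologicalType) :=
  forall x : T, exists (U : set T) (phi : T -> 'rV[R]_n) (psi : 'rV[R]_n -> T),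
    [/\ open U /\ U x,
        open (phi @` U),
        {within U, continuous phi},
        {within phi @` U, continuous psi} &
        forall y, U y -> psi (phi y) = y].

Definition topological_manifold (R : realType) (n : nat)
    (T : topologicalType) : Prop :=
  [/\ hausdorff_space T, @second_countable T & locally_euclidean R n T].

Record homeo_group (T : topologicalType) := HomeoGroup {
  homeo_set :> (T -> T) -> Prop ;
  homeo_group_homeo : forall f, homeo_set f -> homeomorphism f ;
  homeo_group1 : homeo_set id ;
  homeo_groupM : forall f g, homeo_set f -> homeo_set g -> homeo_set (f \o g) ;
  homeo_groupV : forall f, homeo_set f ->
    exists g, [/\ homeo_set g, cancel f g & cancel g f] }.

Definition acts_freely (T : topologicalType) (G : homeo_group T) : Prop :=
  forall (x : T) (gamma : T -> T), G gamma -> gamma x = x -> gamma = id.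

Definition acts_properly_discontinuously (T : topologicalType)
    (G : homeo_group T) : Prop :=
  forall x : T, exists U : set T,
    [/\ open U, U x &
        forall gamma : T -> T, G gamma ->
          (gamma @` U) `&` U !=set0 -> gamma = id].

Section orbit_space.
Variables (T : topologicalType) (G : homeo_group T).

Definition orbit_rel (x y : T) : bool := `[< exists2 gamma, G gamma & gamma x = y >].

Lemma orbit_relP : equiv_class_of orbit_rel.
Proof.
split=> [x|x y|y x z].
- by apply/asboolP; exists id => //; exact: homeo_group1.
- apply/asboolP/asboolP => -[f /homeo_groupV[g [Gg fK gK]] <-];
    by exists g; rewrite ?fK ?gK.
- move=> /asboolP[f Gf <-] /asboolP[g Gg <-]; apply/asboolP.
  by exists (g \o f) => //; exact: homeo_groupM.
Qed.

Canonical orbit_equiv := EquivRelPack orbit_relP.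

Definition orbit_space : topologicalType :=
  quotient_topology {eq_quot orbit_equiv}.

Definition orbit_proj : T -> orbit_space :=
  \pi_(quotient_topology {eq_quot orbit_equiv}).

Lemma orbit_projE (x y : T) :
  orbit_proj x = orbit_proj y <-> exists2 gamma, G gamma & gamma x = y.
Proof. by split=> [/eqmodP/asboolP//|h]; apply/eqmodP/asboolP. Qed.

Lemma orbit_proj_surj (z : orbit_space) : exists x, orbit_proj x = z.
Proof. by exists (repr z); exact: reprK. Qed.

Lemma open_orbit_proj (U : set orbit_space) :
  open U <-> open (orbit_proj @^-1` U).
Proof. by []. Qed.

End orbit_space.

(* Assumptions (i) and (ii) do not force the orbit space to be Hausdorff, so
   that it is a topological manifold is part of the data. *)
Record aspherical_manifold (R : realType) (n : nat) := AsphericalManifold {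
  pi1 : homeo_group 'rV[R]_n ;
  pi1_free : acts_freely pi1 ;
  pi1_properly_discontinuous : acts_properly_discontinuously pi1 ;
  pi1_manifold : topological_manifold R n (orbit_space pi1) }.

Definition manifold_space (R : realType) (n : nat)
    (M : aspherical_manifold R n) : topologicalType := orbit_space (pi1 M).

Definition cover_map (R : realType) (n : nat) (M : aspherical_manifold R n) :
  'rV[R]_n -> manifold_space M := @orbit_proj _ (pi1 M).

Definition is_lift (R : realType) (n : nat) (M : aspherical_manifold R n)
    (fhat : 'rV[R]_n -> 'rV[R]_n) (f : manifold_space M -> manifold_space M) :
    Prop :=
  cover_map M \o fhat = f \o cover_map M.

Definition Aff (R : realType) (n : nat) : set ('rV[R]_n -> 'rV[R]_n) :=
  [set f | exists (A : 'M[R]_n) (b : 'rV[R]_n),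
      A \in unitmx /\ f = (fun x => x *m A + b)].

Definition Aff_manifold (R : realType) (n : nat) (M : aspherical_manifold R n) :
    set (manifold_space M -> manifold_space M) :=
  [set f | homeomorphism f /\
      exists2 fhat, @Aff R n fhat & is_lift fhat f].

Definition N_pi1 (R : realType) (n : nat) (M : aspherical_manifold R n) :
    set ('rV[R]_n -> 'rV[R]_n) :=
  [set g | homeomorphism g /\
      exists2 f, @Aff_manifold R n M f & is_lift g f].

Arguments Aff R n : clear implicits.

(* Main.v *)
(** Both [g] and an affine lift [fhat] lift the same map of [M], so [g x] and
    [fhat x] always lie in one orbit. The sets on which [g] agrees with
    [gamma \o fhat], for [gamma] in the group, partition the connected space
    R^n, and proper discontinuity makes each of them open. *)
Require Import Defs.
From mathcomp Require Import all_boot all_order all_algebra.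
From mathcomp Require Import all_classical all_reals all_analysis.

Import GRing.Theory numFieldNormedType.Exports.
Local Open Scope classical_set_scope.
Local Open Scope ring_scope.

(** The space is a union of lines through the common point [0], each the continuous image of the
    connected real line. *)
Lemma normed_module_connected (R : realType) (V : normedModType R) :
  connected [set: V].
Proof.
have -> : [set: V] = \bigcup_(v in [set: V]) ((fun t : R => t *: v) @` setT).
  apply/seteqP; split=> // v _; exists v => //.
  by exists 1 => //; rewrite scale1r.
apply: bigcup_connected.
  by exists 0 => v _; exists 0 => //; rewrite scale0r.
move=> v _; apply: connected_continuous_connected.
  by apply/connected_intervalP.
by apply: continuous_subspaceT => t; apply: cvgZr_tmp; exact: cvg_id.
Qed.

Lemma mulmxr_continuous (R : realType) (m n : nat) (A : 'M[R]_(m, n)) :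
  continuous (fun x : 'rV[R]_m => x *m A).
Proof.
have -> : (fun x : 'rV[R]_m => x *m A) =
    (fun x => \sum_(i < m) x ord0 i *: row i A).
  by apply/funext => x; rewrite mulmx_sum_row.
apply: continuous_big => [|i _ x]; first exact: add_continuous.
by apply: (@cvgZr_tmp _ _ _ (nbhs x)); exact: coord_continuous.
Qed.

Section orbit_maps.
Variables (S T : topologicalType) (G : homeo_group T).
Hypothesis Gpd : acts_properly_discontinuously G.

(** Near a point of agreement, [u] and [gamma \o v] both take values in one neighbourhood [U] that
    no nontrivial element of [G] makes meet itself. *)
Lemma agreement_open (u v : S -> T) (gamma : T -> T) :
  continuous u -> continuous v -> G gamma ->
  (forall x, exists2 delta, G delta & delta (v x) = u x) ->
  open [set x | u x = gamma (v x)].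
Proof.
move=> cu cv Ggamma uv; rewrite openE => x /= uxE.
have [U [oU Ux UG]] := Gpd (u x).
have [gamma' [Ggamma' gammaK _]] := homeo_groupV Ggamma.
have cgv : {for x, continuous (gamma \o v)}.
  apply: continuous_comp; first exact: cv.
  by have [cgamma _] := homeo_group_homeo Ggamma; exact: cgamma.
have nu : \forall y \near x, U (u y) by apply: cu; exact: open_nbhs_nbhs.
have nv : \forall y \near x, U (gamma (v y)).
  by apply: cgv; apply: open_nbhs_nbhs; rewrite /= -uxE.
near=> y.
have [delta Gdelta deltaE] := uv y.
(* [delta \o gamma'] carries [gamma (v y)] to [u y], both in [U], so it must be the identity. *)
have /(congr1 (@^~ (gamma (v y)))) /= : delta \o gamma' = id.
  apply: UG; first exact: homeo_groupM.
  exists (u y); split; last by near: y.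
  exists (gamma (v y)); first by near: y.
  by rewrite /= gammaK.
by rewrite gammaK deltaE.
Unshelve. all: by end_near.
Qed.

Hypothesis Gfree : acts_freely G.

Lemma connected_same_orbit (u v : S -> T) :
  [set: S] !=set0 -> connected [set: S] -> continuous u -> continuous v ->
  (forall x, exists2 gamma, G gamma & gamma (v x) = u x) ->
  exists2 gamma, G gamma & u = gamma \o v.
Proof.
move=> [x0 _] cS cu cv uv.
(* The value at one base point selects [gamma]; its agreement set is then nonempty, and it remains
   to see that it is clopen. *)
have [gamma Ggamma gammaE] := uv x0.
exists gamma => //.
have [gamma' [Ggamma' gammaK gamma'K]] := homeo_groupV Ggamma.
have oA delta : G delta -> open [set x | u x = delta (v x)].
  by move=> Gdelta; exact: agreement_open.
have : [set x | u x = gamma (v x)] = setT.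
  apply: cS; first by exists x0.
    by exists [set x | u x = gamma (v x)]; rewrite ?setTI//; exact: oA.
  exists [set x | u x = gamma (v x)]; rewrite ?setTI//.
  (* Closedness: a point outside lies in the open agreement set of some other [delta], which is
     disjoint from that of [gamma]. *)
  rewrite -[X in closed X]setCK; apply: open_closedC.
  rewrite openE => x /= ux.
  have [delta Gdelta deltaE] := uv x.
  have : nbhs x [set y | u y = delta (v y)].
    by apply: open_nbhs_nbhs; split; [exact: oA|].
  apply: filterS => y /= -> deltaEgamma; apply: ux; rewrite -deltaE.
  (* If both agreements held at [y], then [gamma' \o delta] would fix [v y], so freeness would force
     [delta] and [gamma] to coincide, in particular at [v x]. *)
  have /(congr1 (@^~ (v x))) /= gdE : gamma' \o delta = id.
    apply: (Gfree (v y)); first exact: homeo_groupM.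
    by rewrite /= deltaEgamma gammaK.
  by rewrite -[LHS]gamma'K gdE.
by move=> uvE; apply/funext => x; have : [set: S] x by []; rewrite -uvE.
Qed.

End orbit_maps.

Theorem proposition2p3 (R : realType) (n : nat) (M : aspherical_manifold R n)
    (g : 'rV[R]_n -> 'rV[R]_n) (hg : N_pi1 M g) :
  exists (fhat : 'rV[R]_n -> 'rV[R]_n) (gamma : 'rV[R]_n -> 'rV[R]_n),
    Aff R n fhat /\ pi1 M gamma /\ g = gamma \o fhat.
Proof.
case: hg => -[cg _] [f [_ [fhat Afhat fhatf]] gf].
have cfhat : continuous fhat.
  have [A [b [_ ->]]] := Afhat.
  move=> x; apply: (@cvgD _ _ _ (nbhs x)); last exact: cvg_cst.
  exact: mulmxr_continuous.
have [||x|gamma Ggamma gE] := @connected_same_orbit _ _ (pi1 M)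
    (@pi1_properly_discontinuous _ _ M) (@pi1_free _ _ M) g fhat _ _ cg cfhat.
- by exists 0.
- exact: normed_module_connected.
(* [fhat x] and [g x] both project to [f (cover_map M x)]. *)
- apply/orbit_projE.
  by rewrite -[LHS]/((cover_map M \o fhat) x) fhatf -gf.
by exists fhat, gamma.
Qed.
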